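(* Let $G=\mathbb H(E,F,A,\omega)$ be a topological generalized Heisenberg group. Then $G$ is a Mumford group if and only if both maps $\omega_E:E\to Chom(F,A)$, $\omega_E(x)(y)=\omega(x,y)$, and $\omega_F:F\to Chom(E,A)$, $\omega_F(y)(x)=\omega(x,y)$, are topological isomorphisms; consequently, in this case $E$ and $F$ are $A$-reflexive.
   Context: For topological groups $X$ and abelian $Y$, $Chom(X,Y)$ is the group of continuous homomorphisms $X\to Y$ with the compact-open topology. A bilinear map $\omega:E\times F\to A$ of abelian groups is separated if for every $0\ne x\in E$ there is $y\in F$ with $\omega(x,y)\neq 0$ and for every $0\neq y\in F$ there is $x\in E$ with $\omega(x,y)\ne 0$. For topological abelian groups $E,F,A$ and a continuous separated bilinear $\omega:E\times F\to A$, the topological generalized Heisenberg group $\mathbb H(E,F,A,\omega)$ is $E\times F\times A$ with the product topology and multiplication $(x,y,z)(x',y',z')=(x+x',y+y',z+z'+\omega(x,y'))$. $\mathcal N_2$ is the class of groups $G$ with $G/Z(G)$ abelian. A topological group $G\in\mathcal N_2$ is a Mumford group if the topological Mumford map $M_t:G/Z(G)\to Chom(G/Z(G),Z(G))$, $M_t(xZ(G))(yZ(G))=[x,y]=x^{-1}y^{-1}xy$, is a topological isomorphism, where $G/Z(G)$ has the quotient topology and $Z(G)$ the subspace topology. For topological abelian groups $E,A$, the group $E$ is $A$-reflexive if the evaluation map $E\to Chom(Chom(E,A),A)$, $x\mapsto(g\mapsto g(x))$, is a topological isomorphism. *)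

(* Defs.v *)
From HB Require Import structures.
From mathcomp Require Import all_boot all_algebra generic_quotient.
From mathcomp Require Import all_classical all_reals topology tvs.

Set Implicit Arguments.
Unset Strict Implicit.
Unset Printing Implicit Defensive.

Import GRing.Theory.
Local Open Scope classical_set_scope.
Local Open Scope quotient_scope.
Local Open Scope group_scope.

HB.mixin Record isTopologicalGroup G of Topological G & Group G := {
  mulg_continuous : continuous (fun xy : G * G => xy.1 * xy.2);
  invg_continuous : continuous (fun x : G => x^-1)
}.

#[short(type="topologicalGroupType")]
HB.structure Definition TopologicalGroup :=
  {G of Topological G & Group G & isTopologicalGroup G}.

HB.mixin Record isAbelianGroup G of Group G := {
  mulgC : forall x y : G, x * y = y * x
}.

#[short(type="topologicalAbelianGroupType")]
HB.structure Definition TopologicalAbelianGroup :=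
  {G of TopologicalGroup G & isAbelianGroup G}.

Lemma cvg_initial (S : choiceType) (T : topologicalType) (f : S -> T)
    (F : set_system S) (s : initial_topology f) :
  Filter F -> f @ F --> f s -> F --> s.
Proof.
move=> FF Ffs A /= [_ [[B oB <-] Bfs sBA]].
by apply: filterS sBA _; apply: Ffs; exact: open_nbhs_nbhs.
Qed.

Lemma continuous_to_initial (X : topologicalType) (S : choiceType)
    (T : topologicalType) (f : S -> T) (h : X -> initial_topology f) :
  continuous (f \o h) -> continuous h.
Proof. by move=> ch x; apply: cvg_initial; exact: ch. Qed.

Section topological_group_theory.
Variable G : topologicalGroupType.

Lemma cvgMg (I : Type) (F : set_system I) (f g : I -> G) (a b : G) :
  Filter F -> f @ F --> a -> g @ F --> b -> f x * g x @[x --> F] --> a * b.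
Proof.
move=> FF fa gb.
apply: (@cvg_comp _ _ _ (fun x => (f x, g x)) (fun xy => xy.1 * xy.2) F
  (nbhs (a, b))); last exact: (mulg_continuous (a, b)).
exact: cvg_pair.
Qed.

Lemma cvgVg (I : Type) (F : set_system I) (f : I -> G) (a : G) :
  Filter F -> f @ F --> a -> (f x)^-1 @[x --> F] --> a^-1.
Proof. by move=> FF fa; apply: (cvg_comp f _ fa); exact: invg_continuous. Qed.

Lemma topological_group_regular : regular_space G.
Proof.
move=> a V Va.
have [[N C] /= [N1 Ca] NCV] : nbhs (1 : G, a) (fun xy => V (xy.1 * xy.2)).
  by apply: (mulg_continuous (1 : G, a)); rewrite /= mul1g.
exists C => // z clCz; have : nbhs z (fun y => N (z * y^-1)).
  have : z * y^-1 @[y --> z] --> z * z^-1.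
    by apply: cvgMg; [exact: cvg_cst|apply: cvgVg; exact: cvg_id].
  by apply; rewrite /= mulgV.
move=> /clCz [y [Cy Nzy]]; have := NCV (z * y^-1, y).
by rewrite /= mulgVK; apply.
Qed.

End topological_group_theory.

(* Topological groups are written multiplicatively, as in [monoid]; [to_mul V]
   is the topological abelian group V : topologicalZmodType with its addition
   written as a multiplication. *)
Notation to_mul := Algebra.to_multiplicative.

HB.instance Definition _ (V : topologicalType) :=
  Topological.copy (to_mul V) V.

HB.instance Definition _ (V : topologicalZmodType) :=
  isTopologicalGroup.Build (to_mul V)
    (@add_continuous V) (@opp_continuous V).

HB.instance Definition _ (V : topologicalZmodType) :=
  isAbelianGroup.Build (to_mul V) (@addrC V).

Definition topological_isomorphism (X Y : topologicalGroupType) (f : X -> Y) :=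
  [/\ {morph f : x y / x * y}, continuous f &
      exists g : Y -> X, [/\ cancel f g, cancel g f & continuous g]].

(* Chom(X, Y): the group law is pointwise multiplication and the topology is
   induced by the compact-open topology on all functions X -> Y. *)
#[short(type="chomType")]
HB.structure Definition ContinuousHom
    (X : topologicalGroupType) (Y : topologicalAbelianGroupType) :=
  {f of isMultiplicative X Y f & @isContinuous X Y f}.

HB.instance Definition _
    (X : topologicalGroupType) (Y : topologicalAbelianGroupType) :=
  gen_eqMixin (chomType X Y).
HB.instance Definition _
    (X : topologicalGroupType) (Y : topologicalAbelianGroupType) :=
  gen_choiceMixin (chomType X Y).
HB.instance Definition _
    (X : topologicalGroupType) (Y : topologicalAbelianGroupType) :=
  Topological.copy (chomType X Y)
    (initial_topology (id : chomType X Y -> {compact-open, X -> Y})).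

Lemma chomP (X : topologicalGroupType) (Y : topologicalAbelianGroupType)
    (f g : chomType X Y) :
  f =1 g -> f = g.
Proof.
case: f g => [f [[fM] [fC]]] [g [[gM] [gC]]]/= /funext fg.
by subst g; rewrite (Prop_irrelevance fM gM) (Prop_irrelevance fC gC).
Qed.

Section chom_group.
Variables (X : topologicalGroupType) (Y : topologicalAbelianGroupType).
Implicit Types f g h : chomType X Y.

Definition chom_one_fun : X -> Y := fun=> 1.
Definition chom_mul_fun f g : X -> Y := fun x => f x * g x.
Definition chom_inv_fun f : X -> Y := fun x => (f x)^-1.

Let chom_one_morph : {morph chom_one_fun : x y / x * y}.
Proof. by move=> x y; rewrite /chom_one_fun mul1g. Qed.
Let chom_one_cts : continuous chom_one_fun.
Proof. by move=> x; exact: cvg_cst. Qed.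
HB.instance Definition _ :=
  isMultiplicative.Build X Y chom_one_fun chom_one_morph.
HB.instance Definition _ := isContinuous.Build X Y chom_one_fun chom_one_cts.

Let chom_mul_morph f g : {morph chom_mul_fun f g : x y / x * y}.
Proof.
move=> x y; rewrite /chom_mul_fun !gmulfM -!mulgA; congr (_ * _).
by rewrite !mulgA (mulgC (f y)).
Qed.
Let chom_mul_cts f g : continuous (chom_mul_fun f g).
Proof. by move=> x; apply: cvgMg; exact: cts_fun. Qed.
HB.instance Definition _ f g :=
  isMultiplicative.Build X Y (chom_mul_fun f g) (chom_mul_morph f g).
HB.instance Definition _ f g :=
  isContinuous.Build X Y (chom_mul_fun f g) (@chom_mul_cts f g).

Let chom_inv_morph f : {morph chom_inv_fun f : x y / x * y}.
Proof. by move=> x y; rewrite /chom_inv_fun gmulfM invgM mulgC. Qed.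
Let chom_inv_cts f : continuous (chom_inv_fun f).
Proof. by move=> x; apply: cvgVg; exact: cts_fun. Qed.
HB.instance Definition _ f :=
  isMultiplicative.Build X Y (chom_inv_fun f) (chom_inv_morph f).
HB.instance Definition _ f :=
  isContinuous.Build X Y (chom_inv_fun f) (@chom_inv_cts f).

Definition chom_one : chomType X Y := chom_one_fun.
Definition chom_mul f g : chomType X Y := chom_mul_fun f g.
Definition chom_inv f : chomType X Y := chom_inv_fun f.

Let chom_mulA : associative chom_mul.
Proof. by move=> f g h; apply: chomP => x; exact: mulgA. Qed.
Let chom_mul1 : left_id chom_one chom_mul.
Proof. by move=> f; apply: chomP => x; exact: mul1g. Qed.
Let chom_mulr1 : right_id chom_one chom_mul.
Proof. by move=> f; apply: chomP => x; exact: mulg1. Qed.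
Let chom_mulV : left_inverse chom_one chom_inv chom_mul.
Proof. by move=> f; apply: chomP => x; exact: mulVg. Qed.
Let chom_mulrV : right_inverse chom_one chom_inv chom_mul.
Proof. by move=> f; apply: chomP => x; exact: mulgV. Qed.

HB.instance Definition _ := isGroup.Build (chomType X Y)
  chom_mulA chom_mul1 chom_mulr1 chom_mulV chom_mulrV.

Let chom_mulC : forall f g : chomType X Y, f * g = g * f.
Proof. by move=> f g; apply: chomP => x; exact: mulgC. Qed.

Lemma chom_near_image f (K : set X) (O : set Y) :
  compact K -> open O -> f @` K `<=` O ->
  nbhs f [set h : chomType X Y | h @` K `<=` O].
Proof.
move=> cK oO fKO.
have := @initial_continuous _ _ (id : chomType X Y -> {compact-open, X -> Y}) f
  [set h | h @` K `<=` O].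
by apply; apply: open_nbhs_nbhs; split; [exact: compact_open_open|].
Qed.

Lemma chom_near_eval f (K : set X) (u : X) (U : set Y) :
  compact K -> K u -> nbhs (f u) U ->
  \forall x \near u & h \near f, K x -> U ((h : chomType X Y) x).
Proof.
move=> cK Ku Ufu.
have [C Cfu clCU] : filter_from (nbhs (f u)) closure (U°).
  exact/topological_group_regular/nbhs_interior.
pose L := K `&` f @^-1` closure C.
have cL : compact L.
  apply: compact_closedI => //; apply: preimage_closed.
    by move=> x _; exact: cts_fun.
  exact: closed_closure.
exists (f @^-1` C, [set h : chomType X Y | h @` L `<=` U°]).
  split; first exact: cts_fun.
  apply: chom_near_image => //; first exact: open_interior.
  by move=> _ [x [Kx clx] <-]; exact: clCU.
case=> x h /= [Cfx hL] Kx; apply: interior_subset; apply: hL; exists x => //.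
by split => //; exact: subset_closure.
Qed.

Let chom_mul_continuous :
  continuous (fun fg : chomType X Y * chomType X Y => fg.1 * fg.2).
Proof.
move=> [f g]; apply: cvg_initial.
apply/compact_open_cvgP => K O cK oO fgO.
suff : \forall fg \near nbhs (f, g),
    K `<=` (fun (fg : chomType X Y * chomType X Y) x => O (fg.1 x * fg.2 x)) fg.
  by apply: filterS => -[f' g'] /= H _ [x Kx <-]; exact: H.
move/compact_near_coveringP/near_covering_withinP: (cK); apply => u Ku.
have : nbhs (f u, g u) [set yz : Y * Y | O (yz.1 * yz.2)].
  apply: (mulg_continuous (f u, g u)); apply: open_nbhs_nbhs; split => //.
  by apply: fgO; exists u.
case=> -[U V] /= [Ufu Vgu] UVO.
have [[A B] /= [Au Bf] ABU] := chom_near_eval cK Ku Ufu.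
have [[A' B'] /= [Au' Bg] ABV] := chom_near_eval cK Ku Vgu.
exists (A `&` A', B `*` B').
  by split; [exact: filterI|exists (B, B')].
case=> x [f' g'] /= [[Ax A'x] [Bf' Bg']] Kx.
apply: (UVO (f' x, g' x)).
by split => /=; [apply: (ABU (x, f'))|apply: (ABV (x, g'))].
Qed.

Let chom_inv_continuous : continuous (fun f : chomType X Y => f^-1).
Proof.
move=> f; have Ff : Filter (nbhs f) by exact: nbhs_filter.
apply: cvg_initial.
apply/compact_open_cvgP => K O cK oO fO.
suff : nbhs f [set f' : chomType X Y | f' @` K `<=` [set y | O y^-1]].
  by apply: filterS => f' /= H _ [x Kx <-]; apply: H; exists x.
apply: chom_near_image => //.
  have /continuousP invo := @invg_continuous Y; exact: (invo O).
by move=> _ [x Kx <-]; apply: fO; exists x.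
Qed.

HB.instance Definition _ := isTopologicalGroup.Build (chomType X Y)
  chom_mul_continuous chom_inv_continuous.

HB.instance Definition _ := isAbelianGroup.Build (chomType X Y) chom_mulC.

End chom_group.

Section center.
Variable G : topologicalGroupType.

Definition center : set G := [set z | forall x, z * x = x * z].

Lemma center1 : center 1.
Proof. by move=> x; rewrite mul1g mulg1. Qed.

Lemma centerM x y : center x -> center y -> center (x * y).
Proof. by move=> cx cy z; rewrite -mulgA (cy z) mulgA (cx z) mulgA. Qed.

Lemma centerV x : center x -> center x^-1.
Proof. by move=> cx z; apply: (mulgI x); rewrite mulVKg mulgA (cx z) mulgK. Qed.

Definition center_type : Type := set_type center.
HB.instance Definition _ := SubChoice.on center_type.
HB.instance Definition _ := Topological.on center_type.

Fact center_group_closed : group_closed [pred x : G | x \in center].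
Proof.
split => [|x y]; rewrite !inE; first exact: center1.
by move=> cx cy; apply: centerM => //; exact: centerV.
Qed.

HB.instance Definition _ :=
  SubChoice_isSubGroup.Build G _ center_type center_group_closed.

Let center_mulC : forall x y : center_type, x * y = y * x.
Proof.
move=> x y; apply: val_inj; rewrite !gmulfM.
by have := valP x; rewrite inE => /(_ (val y)).
Qed.
Lemma center_val_continuous : continuous (val : center_type -> G).
Proof. exact: (@initial_continuous _ _ (set_val : center_type -> G)). Qed.

Let center_mul_continuous :
  continuous (fun xy : center_type * center_type => xy.1 * xy.2).
Proof.
apply: continuous_to_initial => -[x y].
apply: (@cvgMg G _ _ (fun xy => val xy.1) (fun xy => val xy.2)).
  exact: (cvg_comp fst val cvg_fst (@center_val_continuous x)).
exact: (cvg_comp snd val cvg_snd (@center_val_continuous y)).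
Qed.

Let center_inv_continuous : continuous (fun x : center_type => x^-1).
Proof.
apply: continuous_to_initial => x.
exact: (@cvgVg G _ _ val _ _ (@center_val_continuous x)).
Qed.

HB.instance Definition _ := isTopologicalGroup.Build center_type
  center_mul_continuous center_inv_continuous.

HB.instance Definition _ := isAbelianGroup.Build center_type center_mulC.

Definition center_rel : rel G := fun x y => x^-1 * y \in center.

Fact center_rel_refl : reflexive center_rel.
Proof. by move=> x; rewrite /center_rel mulVg inE; exact: center1. Qed.

Fact center_rel_sym : symmetric center_rel.
Proof.
move=> x y; rewrite /center_rel; apply/idP/idP; rewrite !inE => /centerV;
  by rewrite invgM invgK.
Qed.

Fact center_rel_trans : transitive center_rel.
Proof.
move=> y x z; rewrite /center_rel !inE => cxy cyz.
by have := centerM cxy cyz; rewrite mulgA mulgK.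
Qed.

Canonical center_equiv :=
  EquivRel center_rel center_rel_refl center_rel_sym center_rel_trans.

Definition center_quotient : Type := quotient_topology {eq_quot center_equiv}.
HB.instance Definition _ := Topological.on center_quotient.
HB.instance Definition _ := Quotient.on center_quotient.
Local Notation Q := center_quotient.

Lemma center_quotientP (x y : G) : \pi_Q x = \pi_Q y <-> center (x^-1 * y).
Proof.
split=> [/eqmodP|cxy]; first by rewrite /= /center_rel inE.
by apply/eqmodP; rewrite /= /center_rel inE.
Qed.

Definition quot_mul (a b : Q) : Q := \pi_Q (repr a * repr b).
Definition quot_inv (a : Q) : Q := \pi_Q (repr a)^-1.

Lemma pi_mul (x y : G) : \pi_Q (x * y) = quot_mul (\pi_Q x) (\pi_Q y).
Proof.
apply/center_quotientP.
have /esym/center_quotientP := reprK (\pi_Q y).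
have /esym/center_quotientP := reprK (\pi_Q x).
set x' := repr _; set y' := repr _ => cx cy.
have -> : (x * y)^-1 * (x' * y') = y^-1 * (x^-1 * x') * y'.
  by rewrite invgM !mulgA.
by rewrite -mulgA (cx y') mulgA; exact: centerM.
Qed.

Lemma pi_inv (x : G) : \pi_Q x^-1 = quot_inv (\pi_Q x).
Proof.
apply/center_quotientP; rewrite invgK.
have /esym/center_quotientP := reprK (\pi_Q x).
set x' := repr _ => /centerV cx.
have -> : x * x'^-1 = x * (x^-1 * x')^-1 * x^-1.
  by rewrite invgM invgK !mulgA mulgK.
by rewrite -mulgA (cx x^-1) mulVKg.
Qed.

Let quot_mulA : associative quot_mul.
Proof.
elim/quotW=> x; elim/quotW=> y; elim/quotW=> z.
by rewrite -(pi_mul y z) -(pi_mul x y) -(pi_mul x) -(pi_mul _ z) mulgA.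
Qed.
Let quot_mul1 : left_id (\pi_Q 1) quot_mul.
Proof. by elim/quotW=> x; rewrite -(pi_mul 1 x) mul1g. Qed.
Let quot_mulr1 : right_id (\pi_Q 1) quot_mul.
Proof. by elim/quotW=> x; rewrite -(pi_mul x 1) mulg1. Qed.
Let quot_mulV : left_inverse (\pi_Q 1) quot_inv quot_mul.
Proof. by elim/quotW=> x; rewrite -(pi_inv x) -(pi_mul _ x) mulVg. Qed.
Let quot_mulrV : right_inverse (\pi_Q 1) quot_inv quot_mul.
Proof. by elim/quotW=> x; rewrite -(pi_inv x) -(pi_mul x) mulgV. Qed.

HB.instance Definition _ := isGroup.Build center_quotient
  quot_mulA quot_mul1 quot_mulr1 quot_mulV quot_mulrV.

Lemma piM : {morph (\pi_Q : G -> Q) : x y / x * y}.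
Proof. exact: pi_mul. Qed.

Lemma pi_cts : continuous (\pi_Q : G -> Q).
Proof. exact: pi_continuous. Qed.

Lemma pi_open (U : set G) : open U -> open ((\pi_Q : G -> Q) @` U).
Proof.
move=> oU; rewrite /open/= /quotient_open.
have -> : \pi_Q @^-1` (\pi_Q @` U) =
    \bigcup_(z in center) (fun x => x * z) @^-1` U :> set G.
  rewrite eqEsubset; split=> [x [y Uy /esym/center_quotientP cxy]|x [z cz Uxz]].
    by exists (x^-1 * y) => //=; rewrite mulVKg.
  exists (x * z) => //; apply/esym/center_quotientP.
  by rewrite mulKg.
apply: bigcup_open => z _.
have /continuousP : continuous (fun x : G => x * z).
  by move=> x; apply: cvgMg; [exact: cvg_id|exact: cvg_cst].
exact.
Qed.

Lemma nbhs_pi (x : G) (U : set G) : nbhs x U -> nbhs (\pi_Q x) (\pi_Q @` U).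
Proof.
rewrite nbhsE => -[V [oV Vx] VU]; apply: (@filterS _ _ _ (\pi_Q @` V)).
  exact: image_subset.
by apply: open_nbhs_nbhs; split; [exact: pi_open|exists x].
Qed.

Let quot_mul_continuous : continuous (fun ab : Q * Q => ab.1 * ab.2).
Proof.
move=> [+ +]; elim/quotW=> x; elim/quotW=> y W.
rewrite -[X in nbhs X]/((\pi_Q x : Q) * (\pi_Q y : Q)) -piM => /pi_cts.
case/(mulg_continuous (x, y)) => -[U V] /= [Ux Vy] UVW.
exists (\pi_Q @` U, \pi_Q @` V); first by split; exact: nbhs_pi.
case=> a b /= [[x' Ux' <-] [y' Vy' <-]].
by have := UVW (x', y') (conj Ux' Vy'); rewrite /preimage /= piM.
Qed.

Let quot_inv_continuous : continuous (fun a : Q => a^-1).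
Proof.
apply/quotient_continuous => x W.
have piV : \pi_Q x^-1 = (\pi_Q x)^-1 by exact: pi_inv.
rewrite -[X in nbhs X]/((\pi_Q x)^-1) -piV => /pi_cts nW.
have nV : nbhs x [set y | W (\pi_Q y^-1)].
  exact: (@invg_continuous G x _ nW).
suff : nbhs x [set y | W (\pi_Q y)^-1] by [].
by apply: filterS nV => y; rewrite /= pi_inv.
Qed.

HB.instance Definition _ := isTopologicalGroup.Build center_quotient
  quot_mul_continuous quot_inv_continuous.

End center.

Arguments center : clear implicits.

Section mumford.
Variable G : topologicalGroupType.
Local Notation Q := (center_quotient G).
Local Notation Z := (center_type G).

(* The class N_2: groups G such that G / Z(G) is abelian. *)
Definition N2_group := forall a b : Q, a * b = b * a.

Hypothesis N2 : N2_group.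

Fact N2_commg_center (x y : G) : [~ x, y] \in center G.
Proof.
rewrite inE; have /center_quotientP : \pi_Q (y * x) = \pi_Q (x * y).
  by rewrite !piM.
by rewrite invgM !mulgA /commg /conjg !mulgA.
Qed.

Let N2_conjg (x y z : G) : [~ x, y] ^ z = [~ x, y].
Proof.
have := N2_commg_center x y; rewrite inE => cxy.
by rewrite /conjg (cxy z) mulKg.
Qed.

Let commg_centerr (x c : G) : center G c -> [~ x, c] = 1.
Proof. by move=> cc; apply/eqP/commgP; rewrite /commute (cc x). Qed.

Let commg_centerl (x c : G) : center G c -> [~ c, x] = 1.
Proof. by move=> cc; apply/eqP/commgP; exact: cc. Qed.

Let commgMJ (x y z : G) : [~ x, y * z] = [~ x, z] * [~ x, y] ^ z.
Proof.
by rewrite /commg /conjg invgM -!mulgA !mulVKg.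
Qed.

Let commMgJ (x y z : G) : [~ x * y, z] = [~ x, z] ^ y * [~ y, z].
Proof.
by rewrite /commg /conjg invgM -!mulgA !mulVKg.
Qed.

(* [x, y] only depends on the cosets of x and y (see [mumford_funE]), so it is
   computed on the canonical representatives. *)
Definition mumford_fun (a b : Q) : Z :=
  exist _ [~ repr a, repr b] (N2_commg_center (repr a) (repr b)).

Lemma mumford_funE (x y : G) :
  val (mumford_fun (\pi_Q x) (\pi_Q y)) = [~ x, y].
Proof.
have /esym/center_quotientP := reprK (\pi_Q y).
have /esym/center_quotientP := reprK (\pi_Q x).
rewrite /mumford_fun /=; set x' := repr _; set y' := repr _ => cx cy.
rewrite -(mulVKg x x') -(mulVKg y y') commMgJ.
rewrite (commg_centerl _ cx) mulg1 N2_conjg commgMJ.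
by rewrite (commg_centerr _ cy) mul1g N2_conjg.
Qed.

Let mumford_morph a : {morph mumford_fun a : b c / b * c}.
Proof.
elim/quotW: a => x; elim/quotW=> y; elim/quotW=> z; apply: val_inj.
rewrite gmulfM -piM !mumford_funE commgMJ N2_conjg.
have := N2_commg_center x z; rewrite inE => cxz.
by rewrite (cxz [~ x, y]) -!mumford_funE.
Qed.

Let mumford_cts a : continuous (mumford_fun a).
Proof.
elim/quotW: a => x; apply/quotient_continuous.
apply: (@continuous_to_initial _ _ G (set_val : Z -> G)).
rewrite (_ : _ \o _ = fun y => [~ x, y]); last first.
  by apply/funext => y; rewrite -mumford_funE.
move=> y; rewrite /commg /conjg.
apply: cvgMg; first exact: cvg_cst.
apply: cvgMg; first by apply: cvgVg; exact: cvg_id.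
by apply: cvgMg; [exact: cvg_cst|exact: cvg_id].
Qed.

HB.instance Definition _ a :=
  isMultiplicative.Build Q Z (mumford_fun a) (@mumford_morph a).
HB.instance Definition _ a :=
  isContinuous.Build Q Z (mumford_fun a) (@mumford_cts a).

Definition mumford_map (a : Q) : chomType Q Z := mumford_fun a.

End mumford.

Definition mumford_group (G : topologicalGroupType) :=
  exists N2 : N2_group G, topological_isomorphism (mumford_map N2).

Section evaluation.
Variables (E : topologicalGroupType) (A : topologicalAbelianGroupType).

Definition evaluation_fun (x : E) (g : chomType E A) : A := g x.

Let evaluation_morph x : {morph evaluation_fun x : g h / g * h}.
Proof. by []. Qed.

Let evaluation_cts x : continuous (evaluation_fun x).
Proof.
move=> g U; rewrite nbhsE => -[O [oO Ogx] OU].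
have : nbhs g [set h : chomType E A | h @` [set x] `<=` O].
  apply: chom_near_image => //; first exact: compact_set1.
  by move=> _ [_ -> <-].
suff H : [set h : chomType E A | h @` [set x] `<=` O] `<=`
    evaluation_fun x @^-1` U.
  by move=> /filterS; exact.
by move=> h hO; apply: OU; apply: hO; exists x.
Qed.

HB.instance Definition _ x :=
  isMultiplicative.Build (chomType E A) A (evaluation_fun x)
    (@evaluation_morph x).
HB.instance Definition _ x :=
  isContinuous.Build (chomType E A) A (evaluation_fun x) (@evaluation_cts x).

Definition evaluation (x : E) : chomType (chomType E A) A := evaluation_fun x.

End evaluation.

Definition reflexive_for (A E : topologicalAbelianGroupType) :=
  topological_isomorphism (@evaluation E A).

Local Open Scope ring_scope.

Record separated_pairing (E F A : topologicalZmodType) := SeparatedPairing {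
  pairing :> E -> F -> A;
  pairingDl : forall x x' y, pairing (x + x') y = pairing x y + pairing x' y;
  pairingDr : forall x y y', pairing x (y + y') = pairing x y + pairing x y';
  pairing_continuous : continuous (fun xy : E * F => pairing xy.1 xy.2);
  pairing_separatedl : forall x, x != 0 -> exists y, pairing x y != 0;
  pairing_separatedr : forall y, y != 0 -> exists x, pairing x y != 0
}.

Section heisenberg.
Variables (E F A : topologicalZmodType) (w : separated_pairing E F A).

(* w is recorded in the type so that it determines the group law. *)
Definition heisenberg : Type := let _ := w in (E * F * A)%type.
HB.instance Definition _ := Topological.copy heisenberg (E * F * A)%type.
Implicit Types u v : heisenberg.

Definition heis_one : heisenberg := (0, 0, 0).
Definition heis_mul u v : heisenberg :=
  (u.1.1 + v.1.1, u.1.2 + v.1.2, u.2 + v.2 + w u.1.1 v.1.2).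
Definition heis_inv u : heisenberg :=
  (- u.1.1, - u.1.2, - u.2 + w u.1.1 u.1.2).

Let pairing0l y : w 0 y = 0.
Proof. by apply: (addrI (w 0 y)); rewrite -pairingDl !addr0. Qed.
Let pairing0r x : w x 0 = 0.
Proof. by apply: (addrI (w x 0)); rewrite -pairingDr !addr0. Qed.
Let pairingNl x y : w (- x) y = - w x y.
Proof. by apply: (addrI (w x y)); rewrite -pairingDl !subrr pairing0l. Qed.
Let pairingNr x y : w x (- y) = - w x y.
Proof. by apply: (addrI (w x y)); rewrite -pairingDr !subrr pairing0r. Qed.

Let heis_mulA : associative heis_mul.
Proof.
move=> [[x y] z] [[x' y'] z'] [[x'' y''] z'']; rewrite /heis_mul /=.
congr (_, _, _); rewrite ?addrA // pairingDl pairingDr !addrA.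
by rewrite [LHS](ACl (1*2*5*3*6*4)).
Qed.
Let heis_mul1 : left_id heis_one heis_mul.
Proof.
by move=> [[x y] z]; rewrite /heis_mul /= !add0r pairing0l addr0.
Qed.
Let heis_mulr1 : right_id heis_one heis_mul.
Proof.
by move=> [[x y] z]; rewrite /heis_mul /= !addr0 pairing0r addr0.
Qed.
Let heis_mulV : left_inverse heis_one heis_inv heis_mul.
Proof.
move=> [[x y] z]; rewrite /heis_mul /heis_inv /heis_one /= !addNr pairingNl.
by congr (_, _, _); rewrite addrAC addrK addNr.
Qed.
Let heis_mulrV : right_inverse heis_one heis_inv heis_mul.
Proof.
move=> [[x y] z]; rewrite /heis_mul /heis_inv /heis_one /= !subrr pairingNr.
by rewrite addrA subrr add0r subrr.
Qed.

HB.instance Definition _ := isGroup.Build heisenberg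
  heis_mulA heis_mul1 heis_mulr1 heis_mulV heis_mulrV.

Lemma heisM u v :
  (u * v)%g = (u.1.1 + v.1.1, u.1.2 + v.1.2, u.2 + v.2 + w u.1.1 v.1.2).
Proof. by []. Qed.

Lemma heisV u : u^-1%g = (- u.1.1, - u.1.2, - u.2 + w u.1.1 u.1.2).
Proof. by []. Qed.

Let cvgD (V : topologicalZmodType) (T : Type) (H : set_system T)
    (f g : T -> V) (a b : V) :
  Filter H -> f @ H --> a -> g @ H --> b -> f x + g x @[x --> H] --> a + b.
Proof. exact: (@cvgMg (to_mul V)). Qed.

Let cvgN (V : topologicalZmodType) (T : Type) (H : set_system T)
    (f : T -> V) (a : V) :
  Filter H -> f @ H --> a -> - f x @[x --> H] --> - a.
Proof. exact: (@cvgVg (to_mul V)). Qed.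

Let cvg_pairing (T : Type) (H : set_system T) (f : T -> E) (g : T -> F)
    (a : E) (b : F) :
  Filter H -> f @ H --> a -> g @ H --> b -> w (f x) (g x) @[x --> H] --> w a b.
Proof.
move=> HF fa gb.
apply: (@cvg_comp _ _ _ (fun x => (f x, g x)) (fun xy => w xy.1 xy.2) H
  (nbhs (a, b))); last exact: (@pairing_continuous _ _ _ w (a, b)).
exact: cvg_pair.
Qed.

Let cvg_coord u :
  [/\ v.1.1 @[v --> u] --> u.1.1, v.1.2 @[v --> u] --> u.1.2 &
      v.2 @[v --> u] --> u.2].
Proof.
case: u => -[x y] z; split.
- exact: (cvg_comp fst fst cvg_fst cvg_fst).
- exact: (cvg_comp fst snd cvg_fst cvg_snd).
- exact: cvg_snd.
Qed.

Let cvg_heis (T : Type) (H : set_system T) (f : T -> E) (g : T -> F)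
    (h : T -> A) (a : E) (b : F) (c : A) :
  Filter H -> f @ H --> a -> g @ H --> b -> h @ H --> c ->
  (fun x => (f x, g x, h x) : heisenberg) @ H --> ((a, b, c) : heisenberg).
Proof.
move=> HF fa gb hc.
exact: (@cvg_pair _ _ _ H (nbhs (a, b)) (nbhs c) _ _ _ _ _
  (cvg_pair fa gb) hc).
Qed.

Let heis_mul_continuous :
  continuous (fun uv : heisenberg * heisenberg => (uv.1 * uv.2)%g).
Proof.
move=> [u v]; have [u1 u2 u3] := cvg_coord u; have [v1 v2 v3] := cvg_coord v.
have l (T : topologicalType) (f : heisenberg -> T) (a : T) :
    f @ u --> a -> f uv.1 @[uv --> (u, v)] --> a.
  exact: cvg_comp cvg_fst.
have r (T : topologicalType) (f : heisenberg -> T) (a : T) :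
    f @ v --> a -> f uv.2 @[uv --> (u, v)] --> a.
  exact: cvg_comp cvg_snd.
apply: cvg_heis.
- by apply: cvgD; [exact: l u1|exact: r v1].
- by apply: cvgD; [exact: l u2|exact: r v2].
- apply: cvgD; first by apply: cvgD; [exact: l u3|exact: r v3].
  by apply: cvg_pairing; [exact: l u1|exact: r v2].
Qed.

Let heis_inv_continuous : continuous (fun u : heisenberg => u^-1%g).
Proof.
move=> u; have [u1 u2 u3] := cvg_coord u.
apply: cvg_heis.
- exact: cvgN.
- exact: cvgN.
- by apply: cvgD; [exact: cvgN|exact: cvg_pairing].
Qed.

HB.instance Definition _ := isTopologicalGroup.Build heisenberg
  heis_mul_continuous heis_inv_continuous.

End heisenberg.

Section pairing_maps.
Variables (E F A : topologicalZmodType) (w : separated_pairing E F A).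

Definition pairing_E_fun (x : to_mul E) : to_mul F -> to_mul A := w x.
Definition pairing_F_fun (y : to_mul F) : to_mul E -> to_mul A := w^~ y.

Let pairing_E_morph x : {morph pairing_E_fun x : y y' / (y * y')%g}.
Proof. by move=> y y'; exact: pairingDr. Qed.
Let pairing_E_cts x : continuous (pairing_E_fun x).
Proof.
move=> y; apply: (@cvg_comp _ _ _ (fun y => (x, y)) (fun xy => w xy.1 xy.2)
  (nbhs y) (nbhs (x, y))); last exact: (@pairing_continuous _ _ _ w (x, y)).
by apply: cvg_pair; [exact: cvg_cst|exact: cvg_id].
Qed.
HB.instance Definition _ x :=
  isMultiplicative.Build (to_mul F) (to_mul A) (pairing_E_fun x)
    (@pairing_E_morph x).
HB.instance Definition _ x :=
  isContinuous.Build (to_mul F) (to_mul A) (pairing_E_fun x)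
    (@pairing_E_cts x).

Let pairing_F_morph y : {morph pairing_F_fun y : x x' / (x * x')%g}.
Proof. by move=> x x'; exact: pairingDl. Qed.
Let pairing_F_cts y : continuous (pairing_F_fun y).
Proof.
move=> x; apply: (@cvg_comp _ _ _ (fun x => (x, y)) (fun xy => w xy.1 xy.2)
  (nbhs x) (nbhs (x, y))); last exact: (@pairing_continuous _ _ _ w (x, y)).
by apply: cvg_pair; [exact: cvg_id|exact: cvg_cst].
Qed.
HB.instance Definition _ y :=
  isMultiplicative.Build (to_mul E) (to_mul A) (pairing_F_fun y)
    (@pairing_F_morph y).
HB.instance Definition _ y :=
  isContinuous.Build (to_mul E) (to_mul A) (pairing_F_fun y)
    (@pairing_F_cts y).

Definition pairing_E (x : to_mul E) : chomType (to_mul F) (to_mul A) :=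
  pairing_E_fun x.
Definition pairing_F (y : to_mul F) : chomType (to_mul E) (to_mul A) :=
  pairing_F_fun y.

End pairing_maps.

(* Main.v *)
(* In G = H(E, F, A, w) the commutator of (x, y, z) and (x', y', z') is
   (0, 0, w x y' - w x' y), so separation of w gives Z(G) = A and
   G / Z(G) = E x F.  Restricting homomorphisms to the factors identifies
   Chom(E x F, A) with Chom(E, A) x Chom(F, A) topologically, and turns the
   Mumford map into (x, y) |-> (- w_F y, w_E x); hence it is a topological
   isomorphism iff w_E and w_F are.  For reflexivity, the evaluation map of E is
   w_E followed by the inverse of precomposition with w_F. *)
Require Import Defs.
From HB Require Import structures.
From mathcomp Require Import all_boot all_algebra generic_quotient.
From mathcomp Require Import all_classical all_reals topology tvs.

Set Implicit Arguments.
Unset Strict Implicit.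
Unset Printing Implicit Defensive.

Import GRing.Theory.
Local Open Scope classical_set_scope.
Local Open Scope quotient_scope.
Local Open Scope group_scope.

(** * Functoriality of [Chom]: contravariant in the source, covariant in the target *)

Definition mk_chom (X : topologicalGroupType) (Y : topologicalAbelianGroupType)
    (f : X -> Y) (fM : {morph f : x y / x * y}) (fC : continuous f) :
    chomType X Y :=
  HB.pack f (isMultiplicative.Build X Y f fM) (isContinuous.Build X Y f fC).

Section chom_map.
Variables (X X' : topologicalGroupType) (Y Y' : topologicalAbelianGroupType).
Variables (h : X' -> X) (k : Y -> Y').
Hypotheses (hM : {morph h : x y / x * y}) (hC : continuous h).
Hypotheses (kM : {morph k : x y / x * y}) (kC : continuous k).

Let chom_map_morph (f : chomType X Y) : {morph k \o f \o h : x y / x * y}.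
Proof. by move=> x y /=; rewrite hM gmulfM kM. Qed.

Let chom_map_cts (f : chomType X Y) : continuous (k \o f \o h).
Proof.
move=> x; apply: continuous_comp; first exact: hC.
by apply: continuous_comp; [exact: cts_fun|exact: kC].
Qed.

Definition chom_map (f : chomType X Y) : chomType X' Y' :=
  mk_chom (@chom_map_morph f) (@chom_map_cts f).

Lemma chom_mapM : {morph chom_map : f g / f * g}.
Proof. by move=> f g; apply: chomP => x; exact: kM. Qed.

(** The preimage of the subbasic set of maps sending [K] into [O] is the set of maps sending [h @]
    K[into]k @^-1[O]; the former is again compact and the latter again open. *)
Lemma chom_map_continuous : continuous chom_map.
Proof.
move=> f; have Ff : Filter (nbhs f) by exact: nbhs_filter.
apply: cvg_initial; apply/compact_open_cvgP => K O cK oO fO.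
have oO' : open (k @^-1` O) by have /continuousP := kC; apply.
have cK' : compact (h @` K).
  by apply: continuous_compact => //; apply: continuous_subspaceT.
have : nbhs f [set g : chomType X Y | g @` (h @` K) `<=` k @^-1` O].
  apply: chom_near_image => // _ [_ [x Kx <-] <-].
  by apply: fO; exists x.
apply: filterS => g /= gO _ [x Kx <-]; apply: gO.
by exists (h x) => //; exists x.
Qed.

End chom_map.

(** * Center and central quotient of a Heisenberg group, in coordinates *)

Section heisenberg_center.
Variables (E F A : topologicalZmodType) (w : separated_pairing E F A).
Local Notation G := (heisenberg w).
Local Notation Q := (center_quotient G).
Local Notation Z := (center_type G).

Lemma pairing0l y : w 0%R y = 0%R.
Proof. by apply: (addrI (w 0%R y)); rewrite -pairingDl !addr0. Qed.

Lemma pairing0r x : w x 0%R = 0%R.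
Proof. by apply: (addrI (w x 0%R)); rewrite -pairingDr !addr0. Qed.

Lemma pairingNl x y : w (- x)%R y = (- w x y)%R.
Proof. by apply: (addrI (w x y)); rewrite -pairingDl !subrr pairing0l. Qed.

Lemma pairingNr x y : w x (- y)%R = (- w x y)%R.
Proof. by apply: (addrI (w x y)); rewrite -pairingDr !subrr pairing0r. Qed.

Lemma heis_commgE (u v : G) :
  [~ u, v] = ((0, 0, w u.1.1 v.1.2 - w v.1.1 u.1.2)%R : G).
Proof.
(* Multiplying on the left by [v * u] turns the claim into a formula for [u * v], so that no inverse
   has to be expanded. *)
apply: (mulgI (v * u)); rewrite /commg /conjg !mulgA mulgK mulgV mul1g.
rewrite !heisM /=; congr (_, _, _).
- by rewrite addr0 addrC.
- by rewrite addr0 addrC.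
- rewrite pairing0r addr0 (addrC v.2) -!addrA; congr (_ + (_ + _))%R.
  by rewrite addrCA subrr addr0.
Qed.

Lemma heis_centerP (u : G) : center G u <-> u.1 = (0, 0)%R.
Proof.
split=> [cu|].
  have c0 (v : G) : (w u.1.1 v.1.2 - w v.1.1 u.1.2)%R = 0%R.
    have : [~ u, v] = 1 by apply/eqP/commgP; exact: cu.
    by rewrite heis_commgE => -[].
  (* Commuting with [(0, y', 0)] gives [w x y' = 0], and commuting with [(x', 0, 0)] gives
     [w x' y = 0]; separation then forces both coordinates to vanish. *)
  case: u c0 {cu} => -[x y] z /= c0; congr (_, _).
    case: (eqVneq x 0%R) => // /(pairing_separatedl w) [y' /eqP []].
    by have := c0 (0, y', 0)%R; rewrite /= pairing0l subr0.
  case: (eqVneq y 0%R) => // /(pairing_separatedr w) [x' /eqP []].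
  have := c0 (x', 0, 0)%R; rewrite /= pairing0r sub0r => /eqP.
  by rewrite oppr_eq0 => /eqP.
case: u => -[x y] z [-> ->] v; apply/commgP/eqP.
by rewrite heis_commgE /= pairing0l pairing0r subr0.
Qed.

Lemma heis_piP (u v : G) : \pi_Q u = \pi_Q v <-> u.1 = v.1.
Proof.
split.
  move/center_quotientP/heis_centerP; rewrite heisM /=.
  case: u v => -[x y] z [] [x' y'] z' /= [] /eqP + /eqP.
  by rewrite addrC subr_eq0 addrC subr_eq0 => /eqP -> /eqP ->.
move=> uv; apply/center_quotientP/heis_centerP; rewrite heisM /= uv.
by rewrite !addNr.
Qed.

(** By [heis_piP] the first two coordinates are constant on cosets of the center, so the choice of
    representative is harmless for this projection and the next. *)
Definition heis_E (a : Q) : to_mul E := (repr a).1.1.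
Definition heis_F (a : Q) : to_mul F := (repr a).1.2.
Definition heis_A (c : Z) : to_mul A := (val c).2.
Definition E_heis (x : to_mul E) : Q := \pi_Q ((x : E, 0, 0)%R : G).
Definition F_heis (y : to_mul F) : Q := \pi_Q ((0, y : F, 0)%R : G).

Fact A_heis_subproof (z : to_mul A) :
  ((0, 0, z : A)%R : G) \in center G.
Proof. by rewrite inE; apply/heis_centerP. Qed.

Definition A_heis (z : to_mul A) : Z :=
  exist _ ((0, 0, z : A)%R : G) (A_heis_subproof z).

Lemma heis_E_pi u : heis_E (\pi_Q u) = u.1.1.
Proof. by have /heis_piP := reprK (\pi_Q u); rewrite /heis_E => ->. Qed.

Lemma heis_F_pi u : heis_F (\pi_Q u) = u.1.2.
Proof. by have /heis_piP := reprK (\pi_Q u); rewrite /heis_F => ->. Qed.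

Lemma E_heisK : cancel E_heis heis_E.
Proof. by move=> x; rewrite heis_E_pi. Qed.

Lemma F_heisK : cancel F_heis heis_F.
Proof. by move=> y; rewrite heis_F_pi. Qed.

Lemma heis_F_E x : heis_F (E_heis x) = 1.
Proof. by rewrite heis_F_pi. Qed.

Lemma heis_E_F y : heis_E (F_heis y) = 1.
Proof. by rewrite heis_E_pi. Qed.

Lemma A_heisK : cancel A_heis heis_A.
Proof. by []. Qed.

Lemma heis_AK : cancel heis_A A_heis.
Proof.
move=> c; apply: val_inj; have := valP c; rewrite inE => /heis_centerP.
by rewrite /heis_A /=; case: (sval c) => u z /= ->.
Qed.

Lemma E_heisM : {morph E_heis : x y / x * y}.
Proof. by move=> x y; rewrite -piM; apply/heis_piP; rewrite heisM /= addr0. Qed.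

Lemma F_heisM : {morph F_heis : x y / x * y}.
Proof. by move=> x y; rewrite -piM; apply/heis_piP; rewrite heisM /= addr0. Qed.

Lemma heis_EM : {morph heis_E : x y / x * y}.
Proof.
by elim/quotW=> u; elim/quotW=> v; rewrite -piM !heis_E_pi.
Qed.

Lemma heis_FM : {morph heis_F : x y / x * y}.
Proof.
by elim/quotW=> u; elim/quotW=> v; rewrite -piM !heis_F_pi.
Qed.

Lemma A_heisM : {morph A_heis : x y / x * y}.
Proof.
move=> x y; apply: val_inj; rewrite gmulfM /= heisM /=.
by rewrite !addr0 pairing0r addr0.
Qed.

Lemma heis_AM : {morph heis_A : x y / x * y}.
Proof. by move=> x y; apply: (can_inj A_heisK); rewrite A_heisM !heis_AK. Qed.

(** In the group, [(x, 0, 0) * (0, y, 0)] is [(x, y, w x y)], and the quotient forgets the last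
    coordinate. Hence a homomorphism on [Q] is determined by its restrictions to the two factors. *)
Lemma heis_decomp (a : Q) : a = E_heis (heis_E a) * F_heis (heis_F a).
Proof.
elim/quotW: a => u; rewrite heis_E_pi heis_F_pi -piM; apply/heis_piP.
by rewrite heisM /= addr0 add0r; case: u => -[].
Qed.

Lemma heis_cts (T : topologicalType) (f : T -> E) (g : T -> F) (h : T -> A) :
  continuous f -> continuous g -> continuous h ->
  continuous (fun x => (f x, g x, h x) : G).
Proof.
move=> cf cg ch x.
exact: (@cvg_pair _ _ _ (nbhs x) (nbhs (f x, g x)) (nbhs (h x)) _ _ _ _ _
  (cvg_pair (cf x) (cg x)) (ch x)).
Qed.

Lemma E_heis_continuous : continuous E_heis.
Proof.
move=> x; apply: (@continuous_comp _ _ _ (fun x : E => (x, 0, 0)%R : G)).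
  by apply: heis_cts => ?; first [exact: cvg_id|exact: cvg_cst].
exact: pi_cts.
Qed.

Lemma F_heis_continuous : continuous F_heis.
Proof.
move=> x; apply: (@continuous_comp _ _ _ (fun x : F => (0, x, 0)%R : G)).
  by apply: heis_cts => ?; first [exact: cvg_id|exact: cvg_cst].
exact: pi_cts.
Qed.

Lemma heis_E_continuous : continuous heis_E.
Proof.
(* Continuity out of the quotient is tested on the group itself, where the map becomes a coordinate
   projection. *)
apply/quotient_continuous; rewrite (_ : _ \o _ = fun u : G => u.1.1).
  by move=> u; exact: (cvg_comp fst fst cvg_fst cvg_fst).
by apply/funext => u; exact: heis_E_pi.
Qed.

Lemma heis_F_continuous : continuous heis_F.
Proof.
apply/quotient_continuous; rewrite (_ : _ \o _ = fun u : G => u.1.2).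
  by move=> u; exact: (cvg_comp fst snd cvg_fst cvg_snd).
by apply/funext => u; exact: heis_F_pi.
Qed.

Lemma heis_A_continuous : continuous heis_A.
Proof.
move=> c; apply: (@continuous_comp _ _ _ (val : Z -> G) (fun u : G => u.2)).
  exact: center_val_continuous.
exact: cvg_snd.
Qed.

Lemma A_heis_continuous : continuous A_heis.
Proof.
apply: (@continuous_to_initial _ _ G (set_val : Z -> G)).
by apply: heis_cts => ?; first [exact: cvg_id|exact: cvg_cst].
Qed.

(** The law is commutative in the [E] and [F] coordinates, the only ones that survive in the
    quotient. *)
Lemma heis_N2 : N2_group G.
Proof.
elim/quotW=> u; elim/quotW=> v; rewrite -!piM; apply/heis_piP.
by rewrite !heisM /= addrC [X in (_, X)]addrC.
Qed.

End heisenberg_center.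

Arguments heis_E {E F A} w a.
Arguments heis_F {E F A} w a.
Arguments heis_A {E F A} w c.
Arguments A_heisK {E F A} w.

(** * Inverses and composites of topological isomorphisms *)

Lemma topological_isomorphismV (X Y : topologicalGroupType) (f : X -> Y) :
  topological_isomorphism f ->
  exists g, [/\ cancel f g, cancel g f & topological_isomorphism g].
Proof.
case=> fM fC [g [fK gK gC]]; exists g; split => //; split => //.
  by move=> x y; apply: (can_inj fK); rewrite fM !gK.
by exists f.
Qed.

Lemma topological_isomorphism_comp (X Y Z : topologicalGroupType)
    (f : X -> Y) (g : Y -> Z) :
  topological_isomorphism f -> topological_isomorphism g ->
  topological_isomorphism (g \o f).
Proof.
case=> fM fC [f' [fK f'K f'C]] [gM gC [g' [gK g'K g'C]]]; split.
- by move=> x y /=; rewrite fM gM.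
- by move=> x; apply: continuous_comp; [exact: fC|exact: gC].
- exists (f' \o g'); split; [exact: can_comp|exact: can_comp|].
  by move=> x; apply: continuous_comp; [exact: g'C|exact: f'C].
Qed.

(** * The Mumford map of a Heisenberg group, restricted to the two factors *)

Section mumford_heisenberg.
Variables (E F A : topologicalZmodType) (w : separated_pairing E F A).
Local Notation G := (heisenberg w).
Local Notation Q := (center_quotient G).
Local Notation Z := (center_type G).

Definition chom_resE : chomType Q Z -> chomType (to_mul E) (to_mul A) :=
  chom_map (@E_heisM _ _ _ w) (@E_heis_continuous _ _ _ w)
    (@heis_AM _ _ _ w) (@heis_A_continuous _ _ _ w).

Definition chom_resF : chomType Q Z -> chomType (to_mul F) (to_mul A) :=
  chom_map (@F_heisM _ _ _ w) (@F_heis_continuous _ _ _ w)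
    (@heis_AM _ _ _ w) (@heis_A_continuous _ _ _ w).

(** Precomposing with the projection to [E] extends a homomorphism trivially on the factor [F];
    [chom_extF] does the same with the roles exchanged. *)
Definition chom_extE : chomType (to_mul E) (to_mul A) -> chomType Q Z :=
  chom_map (@heis_EM _ _ _ w) (@heis_E_continuous _ _ _ w)
    (@A_heisM _ _ _ w) (@A_heis_continuous _ _ _ w).

Definition chom_extF : chomType (to_mul F) (to_mul A) -> chomType Q Z :=
  chom_map (@heis_FM _ _ _ w) (@heis_F_continuous _ _ _ w)
    (@A_heisM _ _ _ w) (@A_heis_continuous _ _ _ w).

Lemma chom_resEM : {morph chom_resE : f g / f * g}.
Proof. exact: chom_mapM. Qed.

Lemma chom_resFM : {morph chom_resF : f g / f * g}.
Proof. exact: chom_mapM. Qed.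

Lemma chom_extEK : cancel chom_extE chom_resE.
Proof. by move=> f; apply: chomP => x /=; rewrite E_heisK. Qed.

Lemma chom_extFK : cancel chom_extF chom_resF.
Proof. by move=> f; apply: chomP => x /=; rewrite F_heisK. Qed.

(** Evaluate [f] on the decomposition of [a] into its two factors. This makes it enough to compare
    homomorphisms on [E] and on [F] separately. *)
Lemma chom_extK f : chom_extE (chom_resE f) * chom_extF (chom_resF f) = f.
Proof.
apply: chomP => a; rewrite {2}(heis_decomp a) gmulfM.
by congr (_ * _); rewrite /= heis_AK.
Qed.

Lemma chom_res_inj f g :
  chom_resE f = chom_resE g -> chom_resF f = chom_resF g -> f = g.
Proof. by move=> fgE fgF; rewrite -[f]chom_extK fgE fgF chom_extK. Qed.

Variable N2 : N2_group G.

Lemma mumford_map_pi (u v : G) :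
  mumford_map N2 (\pi_Q u) (\pi_Q v) =
  A_heis w (w u.1.1 v.1.2 - w v.1.1 u.1.2)%R.
Proof. by apply: val_inj; rewrite [LHS]mumford_funE heis_commgE. Qed.

(** Against [(x, 0, 0)] only the second term of the commutator survives, with its minus sign; this
    is the source of every inverse attached to [pairing_F] below. *)
Lemma chom_resE_mumford a :
  chom_resE (mumford_map N2 a) = (pairing_F w (heis_F w a))^-1.
Proof.
elim/quotW: a => u; apply: chomP => x; apply: (can_inj (A_heisK w)).
rewrite [LHS]heis_AK mumford_map_pi /= pairing0r sub0r.
by congr (A_heis _ (- w x _)%R); rewrite heis_F_pi.
Qed.

Lemma chom_resF_mumford a :
  chom_resF (mumford_map N2 a) = pairing_E w (heis_E w a).
Proof.
elim/quotW: a => u; apply: chomP => y; apply: (can_inj (A_heisK w)).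
rewrite [LHS]heis_AK mumford_map_pi /= pairing0l subr0.
by congr (A_heis _ (w _ y)); rewrite heis_E_pi.
Qed.

Lemma pairing_EM : {morph pairing_E w : x y / x * y}.
Proof. by move=> x y; apply: chomP => z; exact: pairingDl. Qed.

Lemma pairing_FM : {morph pairing_F w : x y / x * y}.
Proof. by move=> x y; apply: chomP => z; exact: pairingDr. Qed.

(** Left separation applied to [x - x']. Injectivity later upgrades a right inverse of [pairing_E w]
    to a two-sided one. *)
Lemma pairing_E_inj : injective (pairing_E w).
Proof.
move=> x x' xx'; case: (eqVneq (x - x' : E)%R 0%R) => [/eqP|].
  by rewrite subr_eq0 => /eqP.
move=> /(pairing_separatedl w) [y /eqP []].
have xy : w x y = w x' y.
  by rewrite -[LHS]/(pairing_E w x y) xx'.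
by rewrite pairingDl pairingNl xy subrr.
Qed.

Lemma pairing_F_inj : injective (pairing_F w).
Proof.
move=> y y' yy'; case: (eqVneq (y - y' : F)%R 0%R) => [/eqP|].
  by rewrite subr_eq0 => /eqP.
move=> /(pairing_separatedr w) [x /eqP []].
have xy : w x y = w x y'.
  by rewrite -[LHS]/(pairing_F w y x) yy'.
by rewrite pairingDr pairingNr xy subrr.
Qed.

Lemma mumford_mapM : {morph mumford_map N2 : a b / a * b}.
Proof.
move=> a b; apply: chom_res_inj.
  by rewrite chom_resEM !chom_resE_mumford heis_FM pairing_FM invgM mulgC.
by rewrite chom_resFM !chom_resF_mumford heis_EM pairing_EM.
Qed.

End mumford_heisenberg.

Arguments chom_resE {E F A} w f.
Arguments chom_resF {E F A} w f.
Arguments chom_extE {E F A} w f.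
Arguments chom_extF {E F A} w f.

(** * The Mumford condition and the two pairing maps *)

Lemma mumford_heisenberg_pairing (E F A : topologicalZmodType)
    (w : separated_pairing E F A) :
  mumford_group (heisenberg w) ->
  topological_isomorphism (pairing_E w) /\
  topological_isomorphism (pairing_F w).
Proof.
case=> N2 [_ MC [N [MK NK NC]]].
have VC (X : topologicalGroupType) : continuous (fun x : X => x^-1).
  exact: invg_continuous.
split; split.
- exact: pairing_EM.
- rewrite (_ : pairing_E w = chom_resF w \o (mumford_map N2 \o E_heis w)).
    move=> x; apply: continuous_comp; last exact: chom_map_continuous.
    by apply: continuous_comp; [exact: E_heis_continuous|exact: MC].
  by apply/funext => x; rewrite /= chom_resF_mumford E_heisK.
(* A homomorphism on [F] is extended trivially to [Q], pulled back through the Mumford map, and the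
   [E] coordinate of the result is kept. Surjectivity of the Mumford map gives a right inverse;
   injectivity gives the other side. *)
- pose g := heis_E w \o (N \o chom_extF w).
  have gK : cancel g (pairing_E w).
    by move=> f; rewrite -chom_resF_mumford NK chom_extFK.
  exists g; split => //; first exact: (inj_can_sym gK (@pairing_E_inj _ _ _ w)).
  move=> f; apply: continuous_comp; last exact: heis_E_continuous.
  by apply: continuous_comp; [exact: chom_map_continuous|exact: NC].
- exact: pairing_FM.
- rewrite (_ : pairing_F w =
    (fun f => f^-1) \o (chom_resE w \o (mumford_map N2 \o F_heis w))).
    move=> x; apply: continuous_comp; last exact: VC.
    apply: continuous_comp; last exact: chom_map_continuous.
    by apply: continuous_comp; [exact: F_heis_continuous|exact: MC].
  by apply/funext => y; rewrite /= chom_resE_mumford F_heisK invgK.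
(* Same construction on the other factor, with [f] inverted first to absorb the minus sign of the
   commutator. *)
- pose g := heis_F w \o (N \o (chom_extE w \o (fun f => f^-1))).
  have gK : cancel g (pairing_F w).
    by move=> f; apply: invg_inj; rewrite -chom_resE_mumford NK chom_extEK.
  exists g; split => //; first exact: (inj_can_sym gK (@pairing_F_inj _ _ _ w)).
  move=> f; apply: continuous_comp; last exact: heis_F_continuous.
  apply: continuous_comp; last exact: NC.
  by apply: continuous_comp; [exact: VC|exact: chom_map_continuous].
Qed.

Lemma pairing_mumford_heisenberg (E F A : topologicalZmodType)
    (w : separated_pairing E F A) :
  topological_isomorphism (pairing_E w) ->
  topological_isomorphism (pairing_F w) ->
  mumford_group (heisenberg w).
Proof.
case=> _ EC [gE [EK gEK gEC]] [_ FC [gF [FK gFK gFC]]].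
have VC (X : topologicalGroupType) : continuous (fun x : X => x^-1).
  exact: invg_continuous.
pose N2 := @heis_N2 _ _ _ w; exists N2; split; first exact: mumford_mapM.
  (* Rebuilt from its two restrictions, the Mumford map is a pointwise product of composites of
     continuous maps. *)
  have -> : mumford_map N2 = fun a =>
      chom_extE w (pairing_F w (heis_F w a))^-1 *
      chom_extF w (pairing_E w (heis_E w a)).
    apply/funext => a.
    by rewrite -[LHS]chom_extK chom_resE_mumford chom_resF_mumford.
  have cE : continuous
      (chom_extE w \o ((fun f => f^-1) \o (pairing_F w \o heis_F w))).
    move=> a; apply: continuous_comp; last exact: chom_map_continuous.
    apply: continuous_comp; last exact: VC.
    by apply: continuous_comp; [exact: heis_F_continuous|exact: FC].
  have cF : continuous (chom_extF w \o (pairing_E w \o heis_E w)).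
    move=> a; apply: continuous_comp; last exact: chom_map_continuous.
    by apply: continuous_comp; [exact: heis_E_continuous|exact: EC].
  move=> a; exact (cvgMg (nbhs_filter a) (cE a) (cF a)).
(* The restrictions cross over: the one to [F] is [pairing_E] of the [E] coordinate, and the one to
   [E] is the inverse of [pairing_F] of the [F] coordinate. *)
exists (fun f => E_heis w (gE (chom_resF w f)) *
                 F_heis w (gF (chom_resE w f)^-1)); split.
- move=> a; rewrite chom_resE_mumford chom_resF_mumford invgK EK FK.
  by rewrite -heis_decomp.
- move=> f; apply: chom_res_inj.
    by rewrite chom_resE_mumford heis_FM heis_F_E F_heisK mul1g gFK invgK.
  by rewrite chom_resF_mumford heis_EM heis_E_F E_heisK mulg1 gEK.
- have cE : continuous (E_heis w \o (gE \o chom_resF w)).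
    move=> f; apply: continuous_comp; last exact: E_heis_continuous.
    by apply: continuous_comp; [exact: chom_map_continuous|exact: gEC].
  have cF : continuous
      (F_heis w \o (gF \o ((fun f => f^-1) \o chom_resE w))).
    move=> f; apply: continuous_comp; last exact: F_heis_continuous.
    apply: continuous_comp; last exact: gFC.
    by apply: continuous_comp; [exact: chom_map_continuous|exact: VC].
  by move=> f; exact (cvgMg (nbhs_filter f) (cE f) (cF f)).
Qed.

(** * Precomposition isomorphisms and reflexivity *)

Section precomposition.
Variables (X X' : topologicalGroupType) (Y : topologicalAbelianGroupType).
Variables (h : X' -> X).
Hypotheses (hM : {morph h : x y / x * y}) (hC : continuous h).

Definition precomp : chomType X Y -> chomType X' Y :=
  chom_map hM hC (k := id) (fun _ _ => erefl) (fun _ => cvg_id).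

End precomposition.

Lemma precomp_isomorphism (X X' : topologicalGroupType)
    (Y : topologicalAbelianGroupType) (h : X' -> X)
    (hM : {morph h : x y / x * y}) (hC : continuous h) :
  topological_isomorphism h ->
  topological_isomorphism (precomp (Y := Y) hM hC).
Proof.
move=> /topological_isomorphismV [g [hK gK [gM gC _]]].
split; [exact: chom_mapM|exact: chom_map_continuous|].
exists (precomp gM gC); split; last exact: chom_map_continuous.
- by move=> f; apply: chomP => x /=; rewrite gK.
- by move=> f; apply: chomP => x /=; rewrite hK.
Qed.

(** Stated symmetrically in [p] and [q], so that exchanging the two pairing maps yields reflexivity
    of both [E] and [F]. *)
Lemma reflexive_of_pairing (A X Y : topologicalAbelianGroupType)
    (p : X -> chomType Y A) (q : Y -> chomType X A) :
  (forall x y, p x y = q y x) ->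
  topological_isomorphism p -> topological_isomorphism q ->
  reflexive_for A X.
Proof.
move=> pq ip iq; have [qM qC _] := iq.
have /topological_isomorphismV [g [qK gK ig]] :=
  precomp_isomorphism A qM qC iq.
rewrite /reflexive_for (_ : @evaluation X A = g \o p).
  exact: topological_isomorphism_comp.
(* Precomposition with [q] is injective and sends evaluation at [x] to the map taking [y] to
   [q y x], which is [p x y]. *)
apply/funext => x; apply: (can_inj qK); rewrite /= gK.
by apply: chomP => y; rewrite pq.
Qed.

Theorem theorem5p4 (E F A : topologicalZmodType)
    (w : separated_pairing E F A) :
  (mumford_group (heisenberg w) <->
     topological_isomorphism (pairing_E w) /\
     topological_isomorphism (pairing_F w)) /\
  (mumford_group (heisenberg w) ->
     reflexive_for (to_mul A) (to_mul E) /\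
     reflexive_for (to_mul A) (to_mul F)).
Proof.
split; first split.
- exact: mumford_heisenberg_pairing.
- by case; exact: pairing_mumford_heisenberg.
- case/mumford_heisenberg_pairing => iE iF.
  by split; [exact: (reflexive_of_pairing _ iE iF)|
             exact: (reflexive_of_pairing _ iF iE)].
Qed.
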